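(* For all $x$ with $0<x<\pi/2$, $$\frac{(2\pi^{4}/3)x^{3}+(8\pi^{4}/15-16\pi^{2}/3)x^{5}}{(\pi^{2}-4x^{2})^{2}}<x\sec^{2}x-\tan x<\frac{(2\pi^{4}/3)x^{3}+(256/\pi^{2}-8\pi^{2}/3)x^{5}}{(\pi^{2}-4x^{2})^{2}}.$$ Moreover, the constants $8\pi^{4}/15-16\pi^{2}/3$ and $256/\pi^{2}-8\pi^{2}/3$ are the best possible: in the left inequality the coefficient $8\pi^{4}/15-16\pi^{2}/3$ of $x^5$ cannot be replaced by any larger constant, and in the right inequality the coefficient $256/\pi^{2}-8\pi^{2}/3$ of $x^5$ cannot be replaced by any smaller constant, with the corresponding inequality remaining valid for all $x\in(0,\pi/2)$. *)

(* Defs.v *)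
From Stdlib Require Export Reals.

Local Open Scope R_scope.

Definition sec (x : R) : R := / cos x.

(* Main.v *)
Require Import Defs.
From Stdlib Require Import Reals.
From Stdlib Require Import Arith Lra Lia.
From Coquelicot Require Import Coquelicot.

Local Open Scope R_scope.

(** Write [t = (2 x / PI)^2], which runs over [(0,1)].  Euler's partial
    fraction expansion of the tangent,
    [tan x = sum 8 x / (m^2 PI^2 - 4 x^2)] over the odd [m > 0], combined with
    its derivative, gives
    [x sec^2 x - tan x = sum 64 x^3 / (m^2 PI^2 - 4 x^2)^2].
    Multiplying by [(PI^2 - 4 x^2)^2 / x^3], the theorem becomes a statement
    about
    [G(t) = 64 * sum ((1 - t) / (M - t))^2], with [M = m^2 = 1, 9, 25, ...].
    The term of [M = 1] is constant, and each other term is a strictly convex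
    function of [t].  Hence [G] lies strictly above its tangent at [t = 0]
    ([scaled_gap_gt]) and strictly below its chord over [[0,1]]
    ([scaled_gap_lt]); with [G(0) = 2 PI^4 / 3] and [G(1) = 64] these two lines
    are the two bounds of the theorem.  Being the tangent and the chord of [G]
    itself, they cannot be improved.  The second order bound at [0]
    ([scaled_gap_near_0]) and the constant term [64 <= G]
    ([scaled_gap_ge_64]) suffice to prove that.

    The expansion ([gap_series]) comes from the duplication formula of [1/sin^2].
    Iterating it writes [sec^2 x] as a finite sum of values of [1/sin^2] at
    small arguments; since [1/sin^2 y] differs from [1/y^2] by at most [1], this
    is a partial sum of the expansion of [sec^2 x], up to an error that tends
    to [0].  The bounds are uniform in [x] and can be integrated, which gives
    the tangent.

    The equation of the tangent line involves [sum 1/m^4 = PI^4/96] and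
    [sum 1/m^6 = PI^6/960].  Both are read off by comparing the expansion with
    the Taylor polynomial of [x sec^2 x - tan x] at [0] ([odd_zeta_values]). *)

(** * Sums of finitely many terms *)

(** Half-open range, so that [psum a n] has exactly [n] terms: the reversal and
    folding identities below then carry no shift. *)
Fixpoint psum (a : nat -> R) (n : nat) : R :=
  match n with O => 0 | S m => psum a m + a m end.

Lemma sum_n_psum (a : nat -> R) (n : nat) : sum_n a n = psum a (S n).
Proof.
  induction n as [|n IH].
  - rewrite sum_O; simpl; ring.
  - rewrite sum_Sn, IH; reflexivity.
Qed.

Lemma psum_ext (a b : nat -> R) (n : nat) :
  (forall k, (k < n)%nat -> a k = b k) -> psum a n = psum b n.
Proof.
  induction n as [|n IH]; intros H; simpl; [reflexivity|].
  rewrite IH, H; auto with arith.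
Qed.

Lemma psum_le (a b : nat -> R) (n : nat) :
  (forall k, (k < n)%nat -> a k <= b k) -> psum a n <= psum b n.
Proof.
  induction n as [|n IH]; intros H; simpl; [lra|].
  apply Rplus_le_compat; auto with arith.
Qed.

Lemma psum_plus (a b : nat -> R) (n : nat) :
  psum (fun k => a k + b k) n = psum a n + psum b n.
Proof. induction n as [|n IH]; simpl; [ring|rewrite IH; ring]. Qed.

Lemma psum_scal (c : R) (a : nat -> R) (n : nat) :
  psum (fun k => c * a k) n = c * psum a n.
Proof. induction n as [|n IH]; simpl; [ring|rewrite IH; ring]. Qed.

Lemma psum_const (c : R) (n : nat) : psum (fun _ => c) n = INR n * c.
Proof. induction n as [|n IH]; [simpl; ring|simpl psum; rewrite IH, S_INR; ring]. Qed.

Lemma psum_cat (a : nat -> R) (n m : nat) :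
  psum a (n + m) = psum a n + psum (fun k => a (n + k)%nat) m.
Proof.
  induction m as [|m IH]; simpl.
  - rewrite Nat.add_0_r; ring.
  - rewrite Nat.add_succ_r; simpl; rewrite IH; ring.
Qed.

Lemma psum_rev (a : nat -> R) (n : nat) :
  psum a n = psum (fun k => a (n - 1 - k)%nat) n.
Proof.
  induction n as [|n IH]; [reflexivity|].
  change (S n) with (1 + n)%nat at 3; rewrite psum_cat.
  simpl psum; rewrite IH.
  rewrite Rplus_comm; f_equal; [|apply psum_ext; intros k Hk; f_equal; lia].
  rewrite Rplus_0_l; f_equal; lia.
Qed.

Lemma psum_fold (a : nat -> R) (n : nat) :
  psum a (n + n) = psum (fun k => a k + a (n + n - 1 - k)%nat) n.
Proof.
  rewrite psum_cat, psum_plus, (psum_rev (fun k => a (n + k)%nat)).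
  f_equal; apply psum_ext; intros k Hk; f_equal; lia.
Qed.

Lemma psum_incr (a : nat -> R) (n m : nat) :
  (forall k, 0 <= a k) -> (n <= m)%nat -> psum a n <= psum a m.
Proof.
  intros Ha H; induction H as [|m H IH]; simpl; [lra|].
  specialize (Ha m); lra.
Qed.

Lemma is_derive_psum (f df : nat -> R -> R) (n : nat) (x : R) :
  (forall k, is_derive (f k) x (df k x)) ->
  is_derive (fun y => psum (fun k => f k y) n) x (psum (fun k => df k x) n).
Proof.
  intros H; induction n as [|n IH]; simpl.
  - apply (is_derive_const 0).
  - apply (is_derive_plus (fun y => psum (fun k => f k y) n) (f n)); auto.
Qed.

(** * Finite expansion of the squared secant *)

Lemma PI_gt_3 : 3 < PI.
Proof. pose proof PI2_3_2; lra. Qed.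

Definition oddR (k : nat) : R := 2 * INR k + 1.

Lemma odd_ge_1 (k : nat) : 1 <= oddR k.
Proof. unfold oddR; pose proof (pos_INR k); lra. Qed.

Lemma odd_below (k n : nat) : (k < n)%nat -> oddR k <= 2 * INR n - 1.
Proof.
  intros H; unfold oddR; apply (le_INR (S k) n) in H; rewrite S_INR in H; lra.
Qed.

Lemma csc2_double (a : R) : 0 < a < PI ->
  / sin a ^ 2 = / 4 * (/ sin (a / 2) ^ 2 + / sin ((PI - a) / 2) ^ 2).
Proof.
  intros Ha.
  replace ((PI - a) / 2) with (PI / 2 - a / 2) by field.
  rewrite sin_shift.
  assert (Hs : 0 < sin (a / 2)) by (apply sin_gt_0; lra).
  assert (Hc : 0 < cos (a / 2)) by (apply cos_gt_0; lra).
  replace (sin a) with (2 * sin (a / 2) * cos (a / 2))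
    by (rewrite <- sin_2a; f_equal; field).
  pose proof (sin2_cos2 (a / 2)) as E; unfold Rsqr in E.
  replace (/ 4 * (/ sin (a / 2) ^ 2 + / cos (a / 2) ^ 2))
    with (/ 4 * (sin (a / 2) * sin (a / 2) + cos (a / 2) * cos (a / 2))
          / (sin (a / 2) ^ 2 * cos (a / 2) ^ 2)) by (field; lra).
  rewrite E; field; lra.
Qed.

(** The arguments with the two signs are kept together: duplication sends the
    angle of index [k] and sign [+] to those of index [k] and sign [+] and of
    index [2 n - 1 - k] and sign [-]. *)
Definition csc2_pair (x : R) (n k : nat) : R :=
  / sin ((oddR k * PI - 2 * x) / (4 * INR n)) ^ 2
  + / sin ((oddR k * PI + 2 * x) / (4 * INR n)) ^ 2.

(** Halving the angle [a = (m PI + y) / (4 n)] gives [(m PI + y) / (8 n)] and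
    [(PI - a) / 2 = ((4 n - m) PI - y) / (8 n)].  As [m] runs over the odd numbers
    below [2 n], the numbers [4 n - m] are the odd ones between [2 n] and
    [4 n], so the sum with [2 n] terms folds onto the sum with [n] terms. *)
Lemma csc2_pair_double (x : R) (n : nat) :
  - (PI / 2) < x < PI / 2 -> (0 < n)%nat ->
  psum (csc2_pair x (n + n)) (n + n) = 4 * psum (csc2_pair x n) n.
Proof.
  intros Hx Hn.
  rewrite psum_fold, <- psum_scal.
  apply psum_ext; intros k Hk.
  pose proof (odd_ge_1 k) as H1; pose proof (odd_below k n Hk) as H2.
  assert (Hn' : 1 <= INR n) by (apply (le_INR 1); lia).
  pose proof PI_RGT_0 as Hpi.
  unfold csc2_pair.
  assert (Hr : oddR (n + n - 1 - k) = 4 * INR n - oddR k).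
  { unfold oddR; rewrite !minus_INR, plus_INR by lia; simpl; ring. }
  rewrite Hr, plus_INR.
  assert (Hrange : forall y, - PI < y < PI ->
    0 < (oddR k * PI + y) / (4 * INR n) < PI).
  { intros y Hy; split.
    - apply Rdiv_lt_0_compat; nra.
    - apply (Rmult_lt_reg_r (4 * INR n)); [lra|].
      unfold Rdiv; rewrite Rmult_assoc, Rinv_l by lra; nra. }
  assert (Hd : forall y, - PI < y < PI ->
    4 * / sin ((oddR k * PI + y) / (4 * INR n)) ^ 2
    = / sin ((oddR k * PI + y) / (4 * (INR n + INR n))) ^ 2
      + / sin (((4 * INR n - oddR k) * PI - y) / (4 * (INR n + INR n))) ^ 2).
  { intros y Hy; rewrite (csc2_double _ (Hrange y Hy)).
    replace ((oddR k * PI + y) / (4 * INR n) / 2)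
      with ((oddR k * PI + y) / (4 * (INR n + INR n))) by (field; lra).
    replace ((PI - (oddR k * PI + y) / (4 * INR n)) / 2)
      with (((4 * INR n - oddR k) * PI - y) / (4 * (INR n + INR n)))
      by (field; lra).
    lra. }
  pose proof (Hd (2 * x) ltac:(lra)) as E1.
  pose proof (Hd (- (2 * x)) ltac:(lra)) as E2.
  unfold Rminus in *; rewrite Ropp_involutive in E2; lra.
Qed.

Lemma sec2_finite_expansion (x : R) (p : nat) :
  - (PI / 2) < x < PI / 2 ->
  / cos x ^ 2 = / (4 * INR (2 ^ p) ^ 2) * psum (csc2_pair x (2 ^ p)) (2 ^ p).
Proof.
  intros Hx; induction p as [|p IH].
  - simpl psum; unfold csc2_pair, oddR; simpl INR.
    rewrite <- (sin_shift x), csc2_double by lra.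
    replace ((PI - (PI / 2 - x)) / 2) with (((2 * 0 + 1) * PI + 2 * x) / (4 * 1))
      by field.
    replace ((PI / 2 - x) / 2) with (((2 * 0 + 1) * PI - 2 * x) / (4 * 1))
      by field.
    rewrite Rplus_0_l; f_equal; field.
  - replace (2 ^ S p)%nat with (2 ^ p + 2 ^ p)%nat by (simpl; lia).
    assert (Hp : (0 < 2 ^ p)%nat) by (apply Nat.neq_0_lt_0, Nat.pow_nonzero; discriminate).
    rewrite csc2_pair_double, IH, plus_INR by assumption.
    apply lt_0_INR in Hp; field; lra.
Qed.

Lemma tan_gt_id (y : R) : 0 < y < PI / 2 -> y < tan y.
Proof.
  intros Hy.
  destruct (MVT_cor2 tan (fun c => tan c ^ 2 + 1) 0 y) as [c [E Hc]]; [lra| |].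
  - intros c Hc; apply is_derive_Reals, is_derive_tan.
    apply Rgt_not_eq, cos_gt_0; lra.
  - rewrite tan_0 in E; pose proof (tan_gt_0 c ltac:(lra) ltac:(lra)) as H.
    assert (0 < tan c ^ 2 * y) by (apply Rmult_lt_0_compat; [apply pow_lt|]; lra).
    lra.
Qed.

(** The lower bound is [sin y < y]; the upper bound is [y < tan y], because
    [1/sin^2 y - 1 = 1/tan^2 y]. *)
Lemma csc2_bounds (y : R) : 0 < y < PI / 2 ->
  / y ^ 2 <= / sin y ^ 2 <= / y ^ 2 + 1.
Proof.
  intros Hy.
  pose proof (sin_lt_x y ltac:(lra)) as H1.
  assert (Hs : 0 < sin y) by (apply sin_gt_0; lra).
  assert (Hc : 0 < cos y) by (apply cos_gt_0; lra).
  assert (H2 : y * cos y < sin y).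
  { pose proof (tan_gt_id y Hy) as H; unfold tan in H.
    apply (Rmult_lt_compat_r (cos y)) in H; [|assumption].
    unfold Rdiv in H; rewrite Rmult_assoc, Rinv_l in H by lra; lra. }
  pose proof (sin2_cos2 y) as E; unfold Rsqr in E.
  split.
  - apply Rinv_le_contravar; nra.
  - apply (Rmult_le_reg_r (y ^ 2 * sin y ^ 2)).
    { apply Rmult_lt_0_compat; apply pow_lt; lra. }
    replace (/ sin y ^ 2 * (y ^ 2 * sin y ^ 2)) with (y ^ 2) by (field; lra).
    replace ((/ y ^ 2 + 1) * (y ^ 2 * sin y ^ 2))
      with (sin y ^ 2 + y ^ 2 * sin y ^ 2) by (field; lra).
    assert ((y * cos y) ^ 2 <= sin y ^ 2) by (apply pow_incr; nra).
    assert (y ^ 2 * (sin y * sin y + cos y * cos y) = y ^ 2) by (rewrite E; ring).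
    lra.
Qed.

(** * Passage to the partial fractions *)

Definition sec2_term (x : R) (k : nat) : R :=
  4 / (oddR k * PI - 2 * x) ^ 2 + 4 / (oddR k * PI + 2 * x) ^ 2.

Definition tan_term (x : R) (k : nat) : R :=
  2 / (oddR k * PI - 2 * x) - 2 / (oddR k * PI + 2 * x).

(** With [n = 2^p], each of the [2 n] values of [1/sin^2] is at most [1] away
    from its partial fraction and carries the weight [1/(4 n^2)], hence the
    total error [1/(2 n)]. *)
Lemma sec2_approx (x : R) (p : nat) : - (PI / 2) < x < PI / 2 ->
  0 <= / cos x ^ 2 - psum (sec2_term x) (2 ^ p) <= / (2 * 2 ^ p).
Proof.
  intros Hx; rewrite (sec2_finite_expansion x p Hx).
  replace (2 ^ p) with (INR (2 ^ p)) by (rewrite pow_INR; reflexivity).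
  set (n := (2 ^ p)%nat).
  assert (Hn : (0 < n)%nat) by (apply Nat.neq_0_lt_0, Nat.pow_nonzero; discriminate).
  assert (Hn' : 1 <= INR n) by (apply (le_INR 1); lia).
  pose proof PI_RGT_0 as Hpi.
  assert (Hb : forall k, (k < n)%nat -> forall y, - PI < y < PI ->
    4 / (oddR k * PI + y) ^ 2
    <= / (4 * INR n ^ 2) * / sin ((oddR k * PI + y) / (4 * INR n)) ^ 2
    <= 4 / (oddR k * PI + y) ^ 2 + / (4 * INR n ^ 2)).
  { intros k Hk y Hy.
    pose proof (odd_ge_1 k) as H1; pose proof (odd_below k n Hk) as H2.
    assert (0 < oddR k * PI + y) by nra.
    destruct (csc2_bounds ((oddR k * PI + y) / (4 * INR n))) as [L U].
    { split.
      - apply Rdiv_lt_0_compat; nra.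
      - apply (Rmult_lt_reg_r (4 * INR n)); [lra|].
        unfold Rdiv at 1; rewrite Rmult_assoc, Rinv_l by lra; nra. }
    assert (Hi : 0 < / (4 * INR n ^ 2)) by (apply Rinv_0_lt_compat; nra).
    replace (4 / (oddR k * PI + y) ^ 2)
      with (/ (4 * INR n ^ 2) * / ((oddR k * PI + y) / (4 * INR n)) ^ 2)
      by (field; lra).
    split; [|rewrite <- (Rmult_1_r (/ (4 * INR n ^ 2))) at 3;
             rewrite <- Rmult_plus_distr_l];
      apply Rmult_le_compat_l; lra. }
  replace (/ (2 * INR n)) with (INR n * (/ (4 * INR n ^ 2) + / (4 * INR n ^ 2)))
    by (field; lra).
  assert (Hk2 : forall k, (k < n)%nat ->
    sec2_term x k <= / (4 * INR n ^ 2) * csc2_pair x n k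
    <= sec2_term x k + (/ (4 * INR n ^ 2) + / (4 * INR n ^ 2))).
  { intros k Hk; unfold csc2_pair, sec2_term, Rminus.
    pose proof (Hb k Hk (2 * x) ltac:(lra)).
    pose proof (Hb k Hk (- (2 * x)) ltac:(lra)).
    rewrite Rmult_plus_distr_l; lra. }
  rewrite <- psum_scal, <- psum_const.
  split.
  - apply -> Rminus_le_0; apply psum_le; intros k Hk; apply Hk2, Hk.
  - apply Rle_minus_l; rewrite Rplus_comm, <- psum_plus.
    apply psum_le; intros k Hk; apply Hk2, Hk.
Qed.

(** The error of the tangent expansion vanishes at [0] and its derivative is the
    error of [sec2_approx], so the mean value theorem bounds it. *)
Lemma tan_approx (x : R) (p : nat) : 0 < x < PI / 2 ->
  0 <= tan x - psum (tan_term x) (2 ^ p) <= x * / (2 * 2 ^ p).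
Proof.
  intros Hx.
  destruct (MVT_cor2
    (fun y => tan y - psum (tan_term y) (2 ^ p))
    (fun y => / cos y ^ 2 - psum (sec2_term y) (2 ^ p)) 0 x) as [c [E Hc]];
    [lra| |].
  - intros c Hc; apply is_derive_Reals.
    assert (Hcos : cos c <> 0) by (apply Rgt_not_eq, cos_gt_0; lra).
    apply (is_derive_minus tan).
    + replace (/ cos c ^ 2) with (tan c ^ 2 + 1); [apply is_derive_tan, Hcos|].
      unfold tan; pose proof (sin2_cos2 c) as H; unfold Rsqr in H.
      apply (Rmult_eq_reg_r (cos c ^ 2)); [|apply pow_nonzero, Hcos].
      field_simplify; [lra|assumption|assumption].
    + apply (is_derive_psum (fun k y => tan_term y k) (fun k y => sec2_term y k)).
      intros k; unfold tan_term, sec2_term.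
      pose proof (odd_ge_1 k); pose proof PI_RGT_0.
      assert (oddR k * PI - 2 * c <> 0) by nra.
      assert (oddR k * PI + 2 * c <> 0) by nra.
      auto_derive; [tauto|field; tauto].
  - assert (Z : psum (tan_term 0) (2 ^ p) = 0).
    { rewrite (psum_ext _ (fun _ => 0)), psum_const; [ring|].
      intros k _; unfold tan_term.
      pose proof (odd_ge_1 k); pose proof PI_RGT_0; field; nra. }
    rewrite tan_0, Z in E.
    pose proof (sec2_approx c p ltac:(lra)) as B.
    set (d := / cos c ^ 2 - _) in *; clearbody d.
    set (e := / (2 * 2 ^ p)) in *; clearbody e; nra.
Qed.

Definition ratio (x : R) : R := (2 * x / PI) ^ 2.

Lemma ratio_bounds (x : R) : 0 < x < PI / 2 -> 0 < ratio x < 1.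
Proof.
  intros Hx; unfold ratio.
  assert (0 < 2 * x / PI < 1).
  { split; [apply Rdiv_lt_0_compat; lra|].
    apply (Rmult_lt_reg_r PI); [lra|]; field_simplify; lra. }
  nra.
Qed.

Lemma odd2_ge_1 (k : nat) : 1 <= oddR k ^ 2.
Proof. pose proof (odd_ge_1 k); nra. Qed.

(** Partial fractions in the normalized variable: with [t = ratio x],
    [1 / (m^2 PI^2 - 4 x^2)^2] is [1/PI^4] times the term below. *)
Definition fraction (x : R) (k : nat) : R := / (oddR k ^ 2 - ratio x) ^ 2.

Lemma gap_finite_sum (x : R) (n : nat) : 0 < x < PI / 2 ->
  x * psum (sec2_term x) n - psum (tan_term x) n
  = 64 * x ^ 3 / PI ^ 4 * psum (fraction x) n.
Proof.
  intros Hx; rewrite <- !psum_scal.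
  unfold Rminus; rewrite <- (Rmult_1_l (psum (tan_term x) n)),
    Ropp_mult_distr_l, <- psum_scal, <- psum_plus.
  apply psum_ext; intros k _.
  pose proof (odd_ge_1 k); unfold fraction, ratio, sec2_term, tan_term.
  assert (0 < oddR k * PI - 2 * x) by nra.
  assert (0 < oddR k * PI + 2 * x) by nra.
  field.
  assert (0 < (oddR k * PI - 2 * x) * (oddR k * PI + 2 * x))
    by (apply Rmult_lt_0_compat; lra).
  repeat split; nra.
Qed.

(** The approximation is available for [2^p] terms only.  Since the terms are
    positive, the partial sums increase and are bounded, so they converge, and
    their limit is that of this subsequence. *)
Lemma gap_series (x : R) : 0 < x < PI / 2 ->
  is_series (fraction x) (PI ^ 4 / (64 * x ^ 3) * (x * sec x ^ 2 - tan x)).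
Proof.
  intros Hx.
  assert (Hc : 0 < cos x) by (apply cos_gt_0; lra).
  set (l := PI ^ 4 / _ * _).
  set (C := PI ^ 4 / (64 * x ^ 3) * x).
  assert (Hq : 0 < PI ^ 4 / (64 * x ^ 3)).
  { apply Rdiv_lt_0_compat; [apply pow_lt|pose proof (pow_lt x 3)]; lra. }
  assert (Happ : forall p, l - C * (/ 2) ^ p <= psum (fraction x) (2 ^ p)
                           <= l + C * (/ 2) ^ p).
  { intros p.
    pose proof (sec2_approx x p ltac:(lra)) as [S1 S2].
    pose proof (tan_approx x p Hx) as [T1 T2].
    rewrite pow_inv.
    set (e := / 2 ^ p) in *.
    assert (He : 0 < e) by (apply Rinv_0_lt_compat, pow_lt; lra).
    rewrite Rinv_mult in S2, T2; fold e in S2, T2.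
    assert (E : psum (fraction x) (2 ^ p)
      = PI ^ 4 / (64 * x ^ 3)
        * (x * psum (sec2_term x) (2 ^ p) - psum (tan_term x) (2 ^ p))).
    { rewrite gap_finite_sum by assumption; field; lra. }
    rewrite E; unfold l, C, sec; rewrite pow_inv.
    rewrite !Rmult_assoc, <- Rmult_minus_distr_l, <- Rmult_plus_distr_l.
    split; apply Rmult_le_compat_l; nra. }
  assert (Hpos : forall k, 0 <= fraction x k).
  { intros k; unfold fraction; apply Rlt_le, Rinv_0_lt_compat, pow_lt.
    pose proof (odd2_ge_1 k); pose proof (ratio_bounds x Hx); lra. }
  destruct (ex_finite_lim_seq_incr (psum (fraction x)) (l + C)) as [L HL].
  - intros n; apply psum_incr; auto.
  - intros n; apply Rle_trans with (psum (fraction x) (2 ^ n)).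
    + apply psum_incr; [assumption|].
      apply Nat.lt_le_incl, Nat.pow_gt_lin_r; auto.
    + apply (Rle_trans _ _ _ (proj2 (Happ n))).
      assert (0 < C) by (unfold C; apply Rmult_lt_0_compat; lra).
      assert ((/ 2) ^ n <= 1) by (rewrite <- (pow1 n); apply pow_incr; lra).
      nra.
  - assert (Hsub : is_lim_seq (fun p => psum (fraction x) (2 ^ p)) L).
    { apply (is_lim_seq_subseq (psum (fraction x)) L (fun p => (2 ^ p)%nat));
        [|assumption].
      apply eventually_subseq; intros n; apply Nat.pow_lt_mono_r; auto. }
    assert (Hgeom : is_lim_seq (fun p => C * (/ 2) ^ p) 0).
    { replace 0 with (C * 0) by ring; apply (is_lim_seq_scal_l _ C 0).
      apply is_lim_seq_geom; rewrite Rabs_pos_eq; lra. }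
    assert (Hsq : is_lim_seq (fun p => psum (fraction x) (2 ^ p)) l).
    { apply (is_lim_seq_le_le (fun p => l - C * (/ 2) ^ p) _
               (fun p => l + C * (/ 2) ^ p)); [assumption| |].
      - replace l with (l - 0) at 1 by ring.
        apply is_lim_seq_minus'; [apply is_lim_seq_const|assumption].
      - replace l with (l + 0) at 1 by ring.
        apply is_lim_seq_plus'; [apply is_lim_seq_const|assumption]. }
    assert (EL : L = l).
    { apply is_lim_seq_unique in Hsub; apply is_lim_seq_unique in Hsq.
      rewrite Hsub in Hsq; injection Hsq; auto. }
    subst L.
    apply (is_lim_seq_ext (fun n => psum (fraction x) (S n)) _ l).
    + intros n; symmetry; apply sum_n_psum.
    + apply -> is_lim_seq_incr_1; assumption.
Qed.

(** * Comparison of series *)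

Lemma term_le_series (a : nat -> R) (l : R) (n : nat) :
  is_series a l -> (forall k, 0 <= a k) -> a n <= l.
Proof.
  intros Hs Ha.
  apply Rle_trans with (sum_n a n).
  - rewrite sum_n_psum; simpl.
    pose proof (psum_incr a 0 n Ha ltac:(lia)) as H; simpl in H; lra.
  - apply (is_lim_seq_incr_compare (sum_n a)); [exact Hs|].
    intros k; rewrite !sum_n_psum; apply psum_incr; auto.
Qed.

Lemma is_series_le (a b : nat -> R) (la lb : R) :
  is_series a la -> is_series b lb -> (forall k, a k <= b k) -> la <= lb.
Proof.
  intros Ha Hb H.
  assert (b 0%nat - a 0%nat <= lb - la).
  { apply (term_le_series (fun k => b k - a k)).
    - apply (is_series_minus b a lb la Hb Ha).
    - intros k; specialize (H k); lra. }
  specialize (H 0%nat); lra.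
Qed.

(** A difference of series with positive terms is at least its first term, which
    keeps the inequality strict. *)
Lemma is_series_lt (a b : nat -> R) (la lb : R) :
  is_series a la -> is_series b lb -> (forall k, a k < b k) -> la < lb.
Proof.
  intros Ha Hb H.
  assert (b 0%nat - a 0%nat <= lb - la).
  { apply (term_le_series (fun k => b k - a k)).
    - apply (is_series_minus b a lb la Hb Ha).
    - intros k; specialize (H k); lra. }
  specialize (H 0%nat); lra.
Qed.

Lemma is_series_scale (c : R) (a : nat -> R) (l : R) :
  is_series a l -> is_series (fun k => c * a k) (c * l).
Proof. exact (is_series_scal_l c a l). Qed.

Lemma is_series_comb (a b : nat -> R) (la lb c : R) :
  is_series a la -> is_series b lb ->
  is_series (fun k => a k + c * b k) (la + c * lb).
Proof.
  intros Ha Hb; apply (is_series_plus a (fun k => c * b k)); [assumption|].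
  apply is_series_scale, Hb.
Qed.

Lemma is_series_tail (a : nat -> R) (l : R) :
  is_series a l -> is_series (fun k => a (S k)) (l - a 0%nat).
Proof.
  intros H; apply (is_series_incr_1 a (l - a 0%nat)).
  change (is_series a (l - a 0%nat + a 0%nat)).
  replace (l - a 0%nat + a 0%nat) with l by ring; assumption.
Qed.

(** * Taylor expansion at the origin *)

Lemma le_0_of_small (u v d : R) : 0 < d ->
  (forall h, 0 < h < d -> u <= v * h) -> u <= 0.
Proof.
  intros Hd H; destruct (Rle_or_lt u 0) as [|Hu]; [assumption|exfalso].
  assert (Hv : 0 < Rabs v + 1) by (pose proof (Rabs_pos v); lra).
  set (h := Rmin (d / 2) (u / (2 * (Rabs v + 1)))).
  assert (Hh : 0 < h).
  { apply Rmin_pos; [lra|apply Rdiv_lt_0_compat; lra]. }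
  assert (h <= d / 2) by apply Rmin_l.
  assert (h <= u / (2 * (Rabs v + 1))) as H2 by apply Rmin_r.
  apply (Rmult_le_compat_l (Rabs v + 1)) in H2; [|lra].
  replace ((Rabs v + 1) * (u / (2 * (Rabs v + 1)))) with (u / 2) in H2
    by (field; lra).
  pose proof (H h ltac:(lra)); pose proof (Rle_abs v); nra.
Qed.

(** Uniqueness of Taylor coefficients: [a] is bounded by a multiple of [x], and
    then [b] by a multiple of [x^2]. *)
Lemma even_quartic_unique (a b K : R) :
  (forall x, 0 < x < / 2 -> Rabs (a + b * x ^ 2) <= K * x ^ 4) -> a = 0 /\ b = 0.
Proof.
  intros H.
  assert (Hsmall : forall x, 0 < x < / 2 -> 0 < x ^ 2 <= x /\ x ^ 4 <= x ^ 2 * x <= x).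
  { intros x Hx; assert (0 < x ^ 2 < x) by nra.
    replace (x ^ 4) with (x ^ 2 * x ^ 2) by ring; nra. }
  assert (HK : 0 <= K).
  { pose proof (H (/ 4) ltac:(lra)) as H4.
    pose proof (Rabs_pos (a + b * (/ 4) ^ 2)); nra. }
  assert (Ha : a = 0).
  { assert (Rabs a <= 0).
    { apply (le_0_of_small _ (Rabs b + K) (/ 2)); [lra|]; intros x Hx.
      pose proof (H x Hx); destruct (Hsmall x Hx) as [[_ H2] [H3 H4]].
      pose proof (Rabs_triang (a + b * x ^ 2) (- (b * x ^ 2))) as T.
      replace (a + b * x ^ 2 + - (b * x ^ 2)) with a in T by ring.
      rewrite Rabs_Ropp, Rabs_mult, (Rabs_pos_eq (x ^ 2)) in T by nra.
      apply (Rmult_le_compat_l (Rabs b)) in H2; [|apply Rabs_pos].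
      apply (Rle_trans _ _ _ H3), (Rmult_le_compat_l K) in H4; [|assumption].
      lra. }
    pose proof (Rle_abs a); pose proof (Rle_abs (- a)) as N.
    rewrite Rabs_Ropp in N; lra. }
  split; [assumption|].
  assert (Rabs b <= 0).
  { apply (le_0_of_small _ K (/ 2)); [lra|]; intros x Hx.
    pose proof (H x Hx) as Hb; destruct (Hsmall x Hx) as [[H1 _] [H3 _]].
    rewrite Ha, Rplus_0_l, Rabs_mult, (Rabs_pos_eq (x ^ 2)) in Hb by lra.
    apply (Rmult_le_compat_l K) in H3; [|assumption].
    apply (Rmult_le_reg_r (x ^ 2)); lra. }
  pose proof (Rle_abs b); pose proof (Rle_abs (- b)) as N.
  rewrite Rabs_Ropp in N; lra.
Qed.

Lemma gap_half_angle (x : R) : 0 < x < PI / 2 ->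
  x * sec x ^ 2 - tan x = (2 * x - sin (2 * x)) / (1 + cos (2 * x)).
Proof.
  intros Hx; assert (0 < cos x) by (apply cos_gt_0; lra).
  rewrite sin_2a, cos_2a_cos; unfold sec, tan; field; nra.
Qed.

Lemma sin_cos_taylor (y : R) : 0 <= y <= 1 ->
  (y - y ^ 3 / 6 + y ^ 5 / 120 - y ^ 7 / 5040 <= sin y
   <= y - y ^ 3 / 6 + y ^ 5 / 120)
  /\ 1 - y ^ 2 / 2 <= cos y <= 1 - y ^ 2 / 2 + y ^ 4 / 24.
Proof.
  intros Hy; pose proof PI_gt_3.
  destruct (pre_sin_bound y 1) as [S1 _]; [lra|lra|].
  destruct (pre_sin_bound y 0) as [_ S2]; [lra|lra|].
  destruct (cos_bound y 0) as [C1 C2]; [lra|lra|].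
  assert (F2 : INR (fact 2) = 2) by (rewrite INR_IZR_INZ; reflexivity).
  assert (F3 : INR (fact 3) = 6) by (rewrite INR_IZR_INZ; reflexivity).
  assert (F4 : INR (fact 4) = 24) by (rewrite INR_IZR_INZ; reflexivity).
  assert (F5 : INR (fact 5) = 120) by (rewrite INR_IZR_INZ; reflexivity).
  assert (F7 : INR (fact 7) = 5040) by (rewrite INR_IZR_INZ; reflexivity).
  assert (F0 : INR (fact 0) = 1) by reflexivity.
  assert (F1 : INR (fact 1) = 1) by reflexivity.
  unfold sin_approx, sin_term, cos_approx, cos_term in *.
  cbn [sum_f_R0 Nat.add Nat.mul] in S1, S2, C1, C2.
  rewrite ?F0, ?F1, ?F2, ?F3, ?F4, ?F5, ?F7 in *.
  lra.
Qed.

(** With [y = 2 x] the function is [(y - sin y) / (1 + cos y)], whose Taylor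
    polynomial is [y^3/12 + y^5/60]; the remainder is bounded after clearing the
    denominator, which is at least [1]. *)
Lemma gap_taylor (x : R) : 0 < x <= / 2 ->
  Rabs (x * sec x ^ 2 - tan x - (2 / 3 * x ^ 3 + 8 / 15 * x ^ 5)) <= 3 * x ^ 7.
Proof.
  intros Hx; pose proof PI_gt_3.
  rewrite gap_half_angle by lra.
  set (y := 2 * x).
  replace (2 / 3 * x ^ 3 + 8 / 15 * x ^ 5) with (y ^ 3 / 12 + y ^ 5 / 60)
    by (unfold y; field).
  replace (3 * x ^ 7) with (3 / 128 * y ^ 7) by (unfold y; field).
  assert (Hy : 0 < y <= 1) by (unfold y; lra); clearbody y; clear Hx x.
  destruct (sin_cos_taylor y ltac:(lra)) as [[S1 S2] [C1 C2]].
  assert (P : 0 < y ^ 7 /\ 0 < y ^ 3 /\ 0 < y ^ 5) by (repeat split; apply pow_lt; lra).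
  assert (P9 : 0 < y ^ 9) by (apply pow_lt; lra).
  assert (Q : y ^ 9 <= y ^ 7).
  { assert (0 <= y ^ 7 * (1 - y ^ 2)) by (apply Rmult_le_pos; nra); lra. }
  assert (D : 1 <= 1 + cos y) by nra.
  set (q := y ^ 3 / 12 + y ^ 5 / 60).
  assert (Hq : 0 <= q) by (unfold q; lra).
  replace ((y - sin y) / (1 + cos y) - q)
    with ((y - sin y - q * (1 + cos y)) / (1 + cos y)) by (field; lra).
  assert (L : q * (2 - y ^ 2 / 2) <= q * (1 + cos y)
              <= q * (2 - y ^ 2 / 2 + y ^ 4 / 24))
    by (split; apply Rmult_le_compat_l; lra).
  replace (q * (2 - y ^ 2 / 2 + y ^ 4 / 24))
    with (y ^ 3 / 6 - y ^ 5 / 120 - 7 / 1440 * y ^ 7 + y ^ 9 / 1440)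
    in L by (unfold q; field).
  replace (q * (2 - y ^ 2 / 2))
    with (y ^ 3 / 6 - y ^ 5 / 120 - y ^ 7 / 120)
    in L by (unfold q; field).
  assert (N : Rabs (y - sin y - q * (1 + cos y)) <= 3 / 128 * y ^ 7)
    by (apply Rabs_le; lra).
  rewrite Rabs_div, (Rabs_pos_eq (1 + cos y)) by lra.
  apply Rle_div_l; [lra|].
  apply (Rle_trans _ _ _ N); nra.
Qed.

(** * The values of the two odd zeta series *)

Lemma inverse_square_lower (M t : R) : 1 <= M -> 0 <= t < 1 ->
  / M ^ 2 + 2 * t * / M ^ 3 <= / (M - t) ^ 2.
Proof.
  intros HM Ht; apply Rminus_le_0.
  replace (/ (M - t) ^ 2 - (/ M ^ 2 + 2 * t * / M ^ 3))
    with (t ^ 2 * (3 * M - 2 * t) / (M ^ 3 * (M - t) ^ 2)) by (field; lra).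
  apply Rdiv_le_0_compat.
  - apply Rmult_le_pos; [apply pow2_ge_0|lra].
  - apply Rmult_lt_0_compat; apply pow_lt; lra.
Qed.

(** The constant [12 = 3 * 4] comes from the remainder
    [t^2 (3 M - 2 t) / (M^3 (M - t)^2)] and [(M - t)^2 >= 1/4].  The bound keeps
    the factor [1/M^2], so that it can be summed. *)
Lemma inverse_square_upper (M t : R) : 1 <= M -> 0 <= t <= / 2 ->
  / (M - t) ^ 2 <= / M ^ 2 + 2 * t * / M ^ 3 + 12 * t ^ 2 * / M ^ 2.
Proof.
  intros HM Ht; apply Rminus_le_0.
  replace (/ M ^ 2 + 2 * t * / M ^ 3 + 12 * t ^ 2 * / M ^ 2 - / (M - t) ^ 2)
    with (t ^ 2 * (3 * M * (4 * (M - t) ^ 2 - 1) + 2 * t)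
          / (M ^ 3 * (M - t) ^ 2)) by (field; lra).
  apply Rdiv_le_0_compat.
  - apply Rmult_le_pos; [apply pow2_ge_0|].
    assert (/ 2 * / 2 <= (M - t) * (M - t)) by (apply Rmult_le_compat; lra).
    assert (0 <= 3 * M * (4 * (M - t) ^ 2 - 1)) by (apply Rmult_le_pos; lra).
    lra.
  - apply Rmult_lt_0_compat; apply pow_lt; lra.
Qed.

(** Summing the expansion of [1/(M - t)^2] in powers of [t] gives
    [A + 2 t B + O(t^2)], where [A] and [B] are the two sums.  The same function
    of [x] is [PI^4/64 * (2/3 + 8/15 x^2) + O(x^4)] by Taylor's formula, and
    comparing coefficients determines [A] and [B]. *)
Lemma odd_zeta_values :
  is_series (fun k => / (oddR k ^ 2) ^ 2) (PI ^ 4 / 96)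
  /\ is_series (fun k => / (oddR k ^ 2) ^ 3) (PI ^ 6 / 960).
Proof.
  pose proof PI_gt_3 as Hpi.
  assert (Hmono : forall k, 0 <= / (oddR k ^ 2) ^ 3 <= / (oddR k ^ 2) ^ 2).
  { intros k; pose proof (odd2_ge_1 k) as HM.
    set (M := oddR k ^ 2) in *; clearbody M; split.
    - apply Rlt_le, Rinv_0_lt_compat, pow_lt; lra.
    - apply Rinv_le_contravar; [apply pow_lt; lra|].
      apply Rle_pow; [assumption|lia]. }
  assert (ExA : ex_series (fun k => / (oddR k ^ 2) ^ 2)).
  { apply (@ex_series_le R_AbsRing R_CompleteNormedModule _ (fraction (/ 2))).
    - intros k; specialize (Hmono k).
      change (Rabs (/ (oddR k ^ 2) ^ 2) <= fraction (/ 2) k).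
      rewrite Rabs_pos_eq by lra.
      pose proof (ratio_bounds (/ 2) ltac:(lra)) as Ht.
      pose proof (odd2_ge_1 k); unfold fraction.
      apply Rinv_le_contravar; [apply pow_lt; lra|].
      apply pow_incr; lra.
    - eexists; apply gap_series; lra. }
  assert (ExB : ex_series (fun k => / (oddR k ^ 2) ^ 3)).
  { apply (@ex_series_le R_AbsRing R_CompleteNormedModule _
             (fun k => / (oddR k ^ 2) ^ 2)); [|assumption].
    intros k; specialize (Hmono k).
    change (Rabs (/ (oddR k ^ 2) ^ 3) <= / (oddR k ^ 2) ^ 2).
    rewrite Rabs_pos_eq; lra. }
  destruct ExA as [A HA], ExB as [B HB].
  assert (E : A - PI ^ 4 / 96 = 0 /\ 8 * B / PI ^ 2 - PI ^ 4 / 120 = 0).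
  { apply (even_quartic_unique _ _ (192 * A / PI ^ 4 + 3 * PI ^ 4 / 64)).
    intros x Hx.
    pose proof (gap_series x ltac:(lra)) as HF.
    pose proof (gap_taylor x ltac:(lra)) as HT.
    set (g := x * sec x ^ 2 - tan x) in *; clearbody g.
    set (t := ratio x).
    assert (Et : t = 4 * x ^ 2 / PI ^ 2) by (unfold t, ratio; field; lra).
    assert (Ht : 0 <= t <= / 2).
    { rewrite Et; split; [apply Rdiv_le_0_compat; nra|].
      apply Rle_div_l; nra. }
    assert (HAB : is_series (fun k => / (oddR k ^ 2) ^ 2 + 2 * t * / (oddR k ^ 2) ^ 3)
                    (A + 2 * t * B)) by (apply is_series_comb; assumption).
    assert (L : A + 2 * t * B <= PI ^ 4 / (64 * x ^ 3) * g).
    { apply (is_series_le _ _ _ _ HAB HF); intros k.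
      apply inverse_square_lower; [apply odd2_ge_1|fold t; lra]. }
    assert (U : PI ^ 4 / (64 * x ^ 3) * g <= A + 2 * t * B + 12 * t ^ 2 * A).
    { apply (is_series_le _ _ _ _ HF (is_series_comb _ _ _ _ (12 * t ^ 2) HAB HA)).
      intros k; apply inverse_square_upper; [apply odd2_ge_1|assumption]. }
    apply Rabs_le_between in HT.
    set (w := PI ^ 4 / (64 * x ^ 3)) in *.
    assert (Hw : 0 <= w).
    { apply Rdiv_le_0_compat; [apply pow_le|pose proof (pow_lt x 3)]; lra. }
    assert (W : w * - (3 * x ^ 7) <= w * (g - (2 / 3 * x ^ 3 + 8 / 15 * x ^ 5))
                <= w * (3 * x ^ 7)) by (split; apply Rmult_le_compat_l; lra).
    replace (w * - (3 * x ^ 7)) with (- (3 * PI ^ 4 / 64) * x ^ 4) in W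
      by (unfold w; field; lra).
    replace (w * (3 * x ^ 7)) with (3 * PI ^ 4 / 64 * x ^ 4) in W
      by (unfold w; field; lra).
    replace (w * (g - (2 / 3 * x ^ 3 + 8 / 15 * x ^ 5)))
      with (w * g - PI ^ 4 / 96 - PI ^ 4 / 120 * x ^ 2) in W
      by (unfold w; field; lra).
    replace (2 * t * B) with (8 * B / PI ^ 2 * x ^ 2) in L, U
      by (rewrite Et; field; lra).
    replace (12 * t ^ 2 * A) with (192 * A / PI ^ 4 * x ^ 4) in U
      by (rewrite Et; field; lra).
    assert (0 <= 192 * A / PI ^ 4 * x ^ 4) by lra.
    apply Rabs_le; lra. }
  destruct E as [EA EB].
  split.
  - replace (PI ^ 4 / 96) with A by lra; assumption.
  - assert (EB' : PI ^ 6 / 960 = B); [|rewrite EB'; assumption].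
    replace B with (PI ^ 2 / 8 * (8 * B / PI ^ 2)) by (field; lra).
    replace (8 * B / PI ^ 2) with (PI ^ 4 / 120) by lra; field.
Qed.

(** * Tangent and chord bounds *)

Definition scaled_gap (x : R) : R :=
  (x * sec x ^ 2 - tan x) * (PI ^ 2 - 4 * x ^ 2) ^ 2 / x ^ 3.

Lemma scaled_gap_series (x : R) : 0 < x < PI / 2 ->
  is_series (fun k => 64 * ((1 - ratio x) ^ 2 / (oddR k ^ 2 - ratio x) ^ 2))
    (scaled_gap x).
Proof.
  intros Hx.
  replace (scaled_gap x) with (64 * (1 - ratio x) ^ 2
    * (PI ^ 4 / (64 * x ^ 3) * (x * sec x ^ 2 - tan x)))
    by (unfold scaled_gap, ratio; field; lra).
  apply (is_series_ext (fun k => 64 * (1 - ratio x) ^ 2 * fraction x k)).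
  - intros k; unfold fraction, Rdiv; apply Rmult_assoc.
  - apply is_series_scale, gap_series, Hx.
Qed.

Lemma odd2_S_ge_9 (k : nat) : 9 <= oddR (S k) ^ 2.
Proof.
  unfold oddR; rewrite S_INR; pose proof (pos_INR k); nra.
Qed.

(** For [M > 3] the function [t |-> ((1 - t) / (M - t))^2] is strictly convex on
    [[0,1]]; it lies above its tangent at [0]. *)
Lemma tangent_lt (M t : R) : 9 <= M -> 0 < t < 1 ->
  / M ^ 2 + 2 * t * (/ M ^ 3 - / M ^ 2) < (1 - t) ^ 2 / (M - t) ^ 2.
Proof.
  intros HM Ht; apply Rminus_lt_0.
  replace ((1 - t) ^ 2 / (M - t) ^ 2 - (/ M ^ 2 + 2 * t * (/ M ^ 3 - / M ^ 2)))
    with (t ^ 2 * (M - 1) * (M * (M - 3) + 2 * t) / (M ^ 3 * (M - t) ^ 2))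
    by (field; lra).
  apply Rdiv_lt_0_compat.
  - apply Rmult_lt_0_compat; [|nra].
    apply Rmult_lt_0_compat; [apply pow_lt|]; lra.
  - apply Rmult_lt_0_compat; apply pow_lt; lra.
Qed.

(** The chord of the same convex function over [[0,1]], where it vanishes at
    [1]. *)
Lemma chord_gt (M t : R) : 9 <= M -> 0 < t < 1 ->
  (1 - t) ^ 2 / (M - t) ^ 2 < (1 - t) * / M ^ 2.
Proof.
  intros HM Ht; apply Rminus_lt_0.
  replace ((1 - t) * / M ^ 2 - (1 - t) ^ 2 / (M - t) ^ 2)
    with ((1 - t) * (t * (M * (M - 2) + t)) / (M ^ 2 * (M - t) ^ 2))
    by (field; lra).
  apply Rdiv_lt_0_compat.
  - apply Rmult_lt_0_compat; [lra|apply Rmult_lt_0_compat; nra].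
  - apply Rmult_lt_0_compat; apply pow_lt; lra.
Qed.

Lemma scaled_gap_gt (x : R) : 0 < x < PI / 2 ->
  2 * PI ^ 4 / 3 + (8 * PI ^ 4 / 15 - 16 * PI ^ 2 / 3) * x ^ 2 < scaled_gap x.
Proof.
  intros Hx; pose proof (ratio_bounds x Hx) as Ht.
  destruct odd_zeta_values as [HA HB].
  pose proof (is_series_comb _ _ _ _ (-1) HB HA) as HT.
  apply (is_series_comb _ _ _ _ (2 * ratio x) HA) in HT.
  apply (is_series_scale 64), is_series_tail in HT.
  pose proof (is_series_tail _ _ (scaled_gap_series x Hx)) as HG.
  assert (L := is_series_lt _ _ _ _ HT HG).
  cbv beta in L.
  assert (E : oddR 0 = 1) by (unfold oddR; simpl; ring).
  rewrite E in L.
  replace (64 * ((1 - ratio x) ^ 2 / (1 ^ 2 - ratio x) ^ 2)) with 64 in L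
    by (field; lra).
  replace (2 * PI ^ 4 / 3 + (8 * PI ^ 4 / 15 - 16 * PI ^ 2 / 3) * x ^ 2)
    with (64 * (PI ^ 4 / 96 + 2 * ratio x * (PI ^ 6 / 960 + -1 * (PI ^ 4 / 96))))
    by (unfold ratio; field; lra).
  replace (64 * (/ (1 ^ 2) ^ 2 + 2 * ratio x * (/ (1 ^ 2) ^ 3 + -1 * / (1 ^ 2) ^ 2)))
    with 64 in L by field.
  (* Both sides have the first term [64], which is removed. *)
  apply (Rplus_lt_reg_r (- 64)), L; intros k.
  pose proof (tangent_lt _ _ (odd2_S_ge_9 k) Ht); lra.
Qed.

Lemma scaled_gap_lt (x : R) : 0 < x < PI / 2 ->
  scaled_gap x < 2 * PI ^ 4 / 3 + (256 / PI ^ 2 - 8 * PI ^ 2 / 3) * x ^ 2.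
Proof.
  intros Hx; pose proof (ratio_bounds x Hx) as Ht.
  destruct odd_zeta_values as [HA _].
  apply is_series_tail, (is_series_scale (64 * (1 - ratio x))) in HA.
  pose proof (is_series_tail _ _ (scaled_gap_series x Hx)) as HG.
  assert (L := is_series_lt _ _ _ _ HG HA).
  cbv beta in L.
  assert (E : oddR 0 = 1) by (unfold oddR; simpl; ring).
  rewrite E in L.
  replace (64 * ((1 - ratio x) ^ 2 / (1 ^ 2 - ratio x) ^ 2)) with 64 in L
    by (field; lra).
  replace (2 * PI ^ 4 / 3 + (256 / PI ^ 2 - 8 * PI ^ 2 / 3) * x ^ 2)
    with (64 * (1 - ratio x) * (PI ^ 4 / 96 - / (1 ^ 2) ^ 2) + 64)
    by (unfold ratio; field; lra).
  apply Rlt_minus_l, L; intros k.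
  pose proof (chord_gt _ _ (odd2_S_ge_9 k) Ht); lra.
Qed.

(** [64] is the term of [M = 1], and also the value of the sum at [x = PI/2]. *)
Lemma scaled_gap_ge_64 (x : R) : 0 < x < PI / 2 -> 64 <= scaled_gap x.
Proof.
  intros Hx; pose proof (ratio_bounds x Hx) as Ht.
  assert (E : oddR 0 = 1) by (unfold oddR; simpl; ring).
  replace 64 with (64 * ((1 - ratio x) ^ 2 / (oddR 0 ^ 2 - ratio x) ^ 2))
    by (rewrite E; field; lra).
  apply (term_le_series _ _ 0 (scaled_gap_series x Hx)); intros k.
  pose proof (odd2_ge_1 k).
  apply Rmult_le_pos; [lra|].
  apply Rdiv_le_0_compat; [apply pow2_ge_0|apply pow_lt; lra].
Qed.

(** The linear term in [x^2] is the one of [scaled_gap_gt], which makes the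
    tangent bound optimal. *)
Lemma scaled_gap_near_0 (x : R) : 0 < x <= / 2 ->
  scaled_gap x <= 2 * PI ^ 4 / 3 + (8 * PI ^ 4 / 15 - 16 * PI ^ 2 / 3) * x ^ 2
                  + (3 * PI ^ 4 + 100) * x ^ 4.
Proof.
  intros Hx; pose proof PI_gt_3 as Hpi.
  pose proof (gap_taylor x Hx) as HT; apply Rabs_le_between in HT.
  unfold scaled_gap; set (g := x * sec x ^ 2 - tan x) in *; clearbody g.
  apply Rle_trans
    with ((2 / 3 + 8 / 15 * x ^ 2 + 3 * x ^ 4) * (PI ^ 2 - 4 * x ^ 2) ^ 2).
  - apply Rle_div_l; [apply pow_lt; lra|].
    pose proof (pow2_ge_0 (PI ^ 2 - 4 * x ^ 2)) as HD.
    set (D := (PI ^ 2 - 4 * x ^ 2) ^ 2) in *; clearbody D.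
    assert (g * D <= (2 / 3 * x ^ 3 + 8 / 15 * x ^ 5 + 3 * x ^ 7) * D)
      by (apply Rmult_le_compat_r; lra).
    lra.
  - assert (0 < x ^ 2 <= / 4) by nra.
    assert (0 <= x ^ 4) by (apply pow_le; lra).
    assert (0 <= x ^ 4 * (/ 4 - x ^ 2)) by (apply Rmult_le_pos; lra).
    assert (0 <= x ^ 6 * (/ 4 - x ^ 2))
      by (apply Rmult_le_pos; [apply pow_le|]; lra).
    assert (0 <= PI ^ 2 * x ^ 4) by (apply Rmult_le_pos; [apply pow_le|]; lra).
    assert (0 <= PI ^ 2 * x ^ 6)
      by (apply Rmult_le_pos; apply pow_le; lra).
    lra.
Qed.

(** * The inequalities and their optimality *)

(** Both sides are the positive factor [x^3 / (PI^2 - 4 x^2)^2] times the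
    quantities compared on the right of the equivalences. *)
Lemma quotient_vs_scaled_gap (x c : R) : 0 < x < PI / 2 ->
  let q := ((2 * PI ^ 4 / 3) * x ^ 3 + c * x ^ 5) / (PI ^ 2 - 4 * x ^ 2) ^ 2 in
  let p := 2 * PI ^ 4 / 3 + c * x ^ 2 in
  (q < x * sec x ^ 2 - tan x <-> p < scaled_gap x)
  /\ (x * sec x ^ 2 - tan x < q <-> scaled_gap x < p).
Proof.
  intros Hx q p.
  assert (HD : 0 < PI ^ 2 - 4 * x ^ 2) by nra.
  assert (Hw : 0 < x ^ 3 / (PI ^ 2 - 4 * x ^ 2) ^ 2)
    by (apply Rdiv_lt_0_compat; apply pow_lt; lra).
  set (w := x ^ 3 / (PI ^ 2 - 4 * x ^ 2) ^ 2) in *.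
  assert (Eq : q = w * p) by (unfold q, w, p; field; lra).
  assert (Eg : x * sec x ^ 2 - tan x = w * scaled_gap x).
  { unfold scaled_gap, w; field; lra. }
  rewrite Eq, Eg.
  split; split; intros H; first
    [apply (Rmult_lt_reg_l w); assumption
    |apply (Rmult_lt_compat_l w); assumption].
Qed.

Theorem theorem3p2 :
  (forall x : R, 0 < x < PI / 2 ->
     ((2 * PI ^ 4 / 3) * x ^ 3 + (8 * PI ^ 4 / 15 - 16 * PI ^ 2 / 3) * x ^ 5)
       / (PI ^ 2 - 4 * x ^ 2) ^ 2
     < x * sec x ^ 2 - tan x
     < ((2 * PI ^ 4 / 3) * x ^ 3 + (256 / PI ^ 2 - 8 * PI ^ 2 / 3) * x ^ 5)
       / (PI ^ 2 - 4 * x ^ 2) ^ 2)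
  /\
  (forall c : R, 8 * PI ^ 4 / 15 - 16 * PI ^ 2 / 3 < c ->
     ~ (forall x : R, 0 < x < PI / 2 ->
          ((2 * PI ^ 4 / 3) * x ^ 3 + c * x ^ 5) / (PI ^ 2 - 4 * x ^ 2) ^ 2
          < x * sec x ^ 2 - tan x))
  /\
  (forall c : R, c < 256 / PI ^ 2 - 8 * PI ^ 2 / 3 ->
     ~ (forall x : R, 0 < x < PI / 2 ->
          x * sec x ^ 2 - tan x
          < ((2 * PI ^ 4 / 3) * x ^ 3 + c * x ^ 5) / (PI ^ 2 - 4 * x ^ 2) ^ 2)).
Proof.
  pose proof PI_gt_3 as Hpi.
  split; [|split].
  - intros x Hx; split.
    + apply quotient_vs_scaled_gap, scaled_gap_gt; assumption.
    + apply quotient_vs_scaled_gap, scaled_gap_lt; assumption.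
  - intros c Hc H.
    (* Near [0] the excess of [c], times [x^2], is at most [K x^4]. *)
    assert (c - (8 * PI ^ 4 / 15 - 16 * PI ^ 2 / 3) <= 0); [|lra].
    apply (le_0_of_small _ (3 * PI ^ 4 + 100) (/ 2)); [lra|]; intros x Hx.
    assert (L := H x ltac:(lra)); apply quotient_vs_scaled_gap in L; [|lra].
    pose proof (scaled_gap_near_0 x ltac:(lra)) as U.
    set (c0 := 8 * PI ^ 4 / 15 - 16 * PI ^ 2 / 3) in *.
    set (K := 3 * PI ^ 4 + 100) in *.
    assert (HK : 0 < K) by (pose proof (pow_lt PI 4); unfold K; lra).
    assert (H2 : c - c0 <= K * x ^ 2).
    { apply (Rmult_le_reg_r (x ^ 2)); [apply pow_lt|]; lra. }
    apply (Rle_trans _ _ _ H2), Rmult_le_compat_l; nra.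
  - intros c Hc H.
    assert (P : 256 / PI ^ 2 - 8 * PI ^ 2 / 3 = 4 / PI ^ 2 * (64 - 2 * PI ^ 4 / 3))
      by (field; lra).
    (* Let [x = PI/2 - h] tend to [PI/2], where the sum stays above [64]. *)
    assert (64 - 2 * PI ^ 4 / 3 - c * PI ^ 2 / 4 <= 0).
    { apply (le_0_of_small _ (Rabs c * PI) (PI / 2)); [lra|]; intros h Hh.
      assert (L := H (PI / 2 - h) ltac:(lra)).
      apply quotient_vs_scaled_gap in L; [|lra].
      pose proof (scaled_gap_ge_64 (PI / 2 - h) ltac:(lra)).
      assert (- c * (PI * h - h ^ 2) <= Rabs c * (PI * h)).
      { assert (0 <= h * (PI - h)) by (apply Rmult_le_pos; lra).
        apply Rle_trans with (Rabs c * (PI * h - h ^ 2)).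
        - apply Rmult_le_compat_r; [lra|].
          rewrite <- Rabs_Ropp; apply Rle_abs.
        - apply Rmult_le_compat_l; [apply Rabs_pos|nra]. }
      lra. }
    assert (256 / PI ^ 2 - 8 * PI ^ 2 / 3 <= c); [|lra].
    rewrite P; apply (Rmult_le_reg_l (PI ^ 2 / 4)); [nra|].
    replace (PI ^ 2 / 4 * (4 / PI ^ 2 * (64 - 2 * PI ^ 4 / 3)))
      with (64 - 2 * PI ^ 4 / 3) by (field; lra).
    lra.
Qed.
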